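(* Let $(X,d_X)$ and $(Y,d_Y)$ be uniformly perfect metric spaces, each with more than one point, and let $\Phi$ be an admissible function. Let $d_{X\times Y}$ be a metric on $X\times Y$ such that there exist constants $c_1,c_2\in(0,\infty)$ with $$c_1\max\{d_X(x,x'),d_Y(y,y')\}\le d_{X\times Y}((x,y),(x',y'))\le c_2\max\{d_X(x,x'),d_Y(y,y')\}$$ for all $x,x'\in X$, $y,y'\in Y$. Let $E\subseteq X$ and $F\subseteq Y$ be non-empty and totally bounded with finite Assouad dimension. Then (i) $\overline{\dim}^\Phi E+\underline{\dim}^\Phi F\le\overline{\dim}^\Phi(E\times F)\le\overline{\dim}^\Phi E+\overline{\dim}_{\mathrm B}F$; (ii) $\underline{\dim}^\Phi E+\underline{\dim}^\Phi F\le\underline{\dim}^\Phi(E\times F)\le\underline{\dim}^\Phi E+\overline{\dim}_{\mathrm B}F$. In the case of self-products ($X=Y$ and $E=F$), (i) can be improved to (iii) $2\,\overline{\dim}^\Phi F\le\overline{\dim}^\Phi(F\times F)\le\overline{\dim}^\Phi F+\overline{\dim}_{\mathrm B}F$.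
   Context: For a subset $U$ of a metric space, $|U|$ denotes its diameter, and $B(x,r)$ is the open ball. Convention: $\inf\varnothing=\infty$. A metric space $X$ is uniformly perfect if there is $c\in(0,1)$ such that $B(x,R)\setminus B(x,cR)\neq\varnothing$ for all $x\in X$ and $0<R<|X|$. $N_\delta(F)$ is the smallest number of open balls of radius $\delta/2$ with centres in $F$ needed to cover $F$; $F$ is totally bounded if $N_\delta(F)<\infty$ for all $\delta>0$. A function $\Phi\colon(0,\Delta)\to\mathbb{R}$ (for some $\Delta>0$) is admissible if it is monotonic, $0<\Phi(\delta)\le\delta$ for all $\delta\in(0,\Delta)$, and $\Phi(\delta)/\delta\to0$ as $\delta\to0^+$. For a non-empty totally bounded subset $F$ of a metric space and admissible $\Phi$, the upper $\Phi$-intermediate dimension $\overline{\dim}^\Phi F$ is the infimum of all $s\ge0$ such that for all $\epsilon>0$ there exists $\delta_0\in(0,1]$ (with $(0,\delta_0)$ contained in the domain of $\Phi$) such that for all $\delta\in(0,\delta_0)$ there is a finite or countable cover $\{U_1,U_2,\dots\}$ of $F$ by subsets of the ambient space with $\Phi(\delta)\le|U_i|\le\delta$ for all $i$ and $\sum_i|U_i|^s\le\epsilon$. The lower $\Phi$-intermediate dimension $\underline{\dim}^\Phi F$ is the infimum of all $s\ge0$ such that for all $\epsilon>0$ and $\delta_0\in(0,1]$ there exist $\delta\in(0,\delta_0)$ (in the domain of $\Phi$) and such a cover of $F$ with $\Phi(\delta)\le|U_i|\le\delta$ for all $i$ and $\sum_i|U_i|^s\le\epsilon$. (The ambient space is $X$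 for $E$, $Y$ for $F$, and $(X\times Y,d_{X\times Y})$ for $E\times F$.) $\overline{\dim}_{\mathrm B}F:=\limsup_{\delta\to0^+}\log N_\delta(F)/(-\log\delta)$ is the upper box dimension. The Assouad dimension $\dim_{\mathrm A}F$ is the infimum of all $a$ for which there exists $C>0$ such that $N_r(B(x,R)\cap F)\le C(R/r)^a$ for all $x\in F$ and $0<r<R$. *)

(* Defs.v *)
From HB Require Import structures.
From mathcomp Require Import all_boot all_order all_algebra.
From mathcomp Require Import all_classical all_reals all_analysis.

Set Implicit Arguments.
Unset Strict Implicit.
Unset Printing Implicit Defensive.

Import Order.TTheory GRing.Theory Num.Theory.
Import numFieldNormedType.Exports.

Local Open Scope classical_set_scope.
Local Open Scope ring_scope.

Record is_metric (R : realType) (T : Type) (d : T -> T -> R) : Prop := IsMetric {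
  is_metricxx : forall x, d x x = 0 ;
  is_metric_eq0 : forall x y, d x y = 0 -> x = y ;
  is_metric_sym : forall x y, d x y = d y x ;
  is_metric_triangle : forall y x z, d x z <= d x y + d y z }.

(* A copy of T whose metricType structure is given by d.  On T := X * Y it
   shadows the product (pseudo)metric structure provided by the library. *)
Definition metrized (R : realType) (T : choiceType) (d : T -> T -> R)
  (hd : is_metric d) : Type := T.

Section Metrized.
Context (R : realType) (T : choiceType) (d : T -> T -> R) (hd : is_metric d).

HB.instance Definition _ := Choice.on (metrized hd).
HB.instance Definition _ := @isMetric.Build R (metrized hd) d
  (is_metricxx hd) (is_metric_eq0 hd) (is_metric_sym hd) (is_metric_triangle hd).

Lemma mdist_metrized : @mdist R (metrized hd) = d.
Proof. by []. Qed.

End Metrized.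

Definition comparable_to_max (R : realType) (X Y : metricType R)
    (d : X * Y -> X * Y -> R) : Prop :=
  exists c1 c2 : R, [/\ 0 < c1, 0 < c2 &
    forall (x x' : X) (y y' : Y),
      c1 * Num.max (mdist x x') (mdist y y') <= d (x, y) (x', y')
        <= c2 * Num.max (mdist x x') (mdist y y')].

(* Phi is a total function, but only its values on ]0, Delta[ are ever used.
   Monotonic means nondecreasing or nonincreasing. *)
Definition admissible (R : realType) (Delta : R) (Phi : R -> R) : Prop :=
  [/\ 0 < Delta,
      {in `]0, Delta[ &, {homo Phi : x y / x <= y}} \/
      {in `]0, Delta[ &, {homo Phi : x y /~ x <= y}},
      forall delta, 0 < delta < Delta -> 0 < Phi delta <= delta &
      Phi delta / delta @[delta --> 0^'+] --> (0 : R)].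

Section Dimensions.
Context {R : realType} {T : metricType R}.
Implicit Types (F U : set T) (Delta delta s : R) (Phi : R -> R).

(* Adding 0 only matters for U = set0, whose diameter is thus 0. *)
Definition diam U : \bar R :=
  ereal_sup (0%:E |` [set (mdist x y)%:E | x in U & y in U]).

(* The value is +oo if F has no such finite cover. *)
Definition covering_number delta F : \bar R :=
  ereal_inf [set n%:R%:E | n in [set n : nat | exists c : 'I_n -> T,
    (forall i, F (c i)) /\ F `<=` \bigcup_i ball (c i) (delta / 2)]].

Definition totally_bounded F : Prop :=
  forall delta, 0 < delta -> (covering_number delta F < +oo)%E.

Definition upper_box_dim F : \bar R :=
  limf_esup (fun delta : R => lne (covering_number delta F) / (- ln delta)%:E)%E
    0^'+.

Definition assouad_dim F : \bar R :=
  ereal_inf [set a%:E | a in [set a : R | exists2 C : R, 0 < C &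
    forall (x : T) (r rho : R), F x -> 0 < r < rho ->
      (covering_number r (ball x rho `&` F) <= (C * (rho / r) `^ a)%:E)%E]].

(* A finite or countable cover is a family indexed by a set I of naturals. *)
Definition has_cover Phi delta s (eps : R) F : Prop :=
  exists (I : set nat) (U : nat -> set T),
    [/\ F `<=` \bigcup_(i in I) U i,
        forall i, I i -> ((Phi delta)%:E <= diam (U i) <= delta%:E)%E &
        (\esum_(i in I) (diam (U i) `^ s) <= eps%:E)%E].

Definition upper_intermediate_dim Delta Phi F : \bar R :=
  ereal_inf [set s%:E | s in [set s : R | 0 <= s /\
    forall eps : R, 0 < eps ->
      exists delta0 : R, [/\ 0 < delta0 <= 1, delta0 <= Delta &
        forall delta, 0 < delta < delta0 -> has_cover Phi delta s eps F]]].

Definition lower_intermediate_dim Delta Phi F : \bar R :=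
  ereal_inf [set s%:E | s in [set s : R | 0 <= s /\
    forall eps delta0 : R, 0 < eps -> 0 < delta0 <= 1 ->
      exists delta, [/\ 0 < delta < delta0, delta < Delta &
        has_cover Phi delta s eps F]]].

End Dimensions.

(* The ambient space of the covers is made explicit. *)
Arguments upper_intermediate_dim {R} T Delta Phi F.
Arguments lower_intermediate_dim {R} T Delta Phi F.

Definition uniformly_perfect (R : realType) (T : metricType R) : Prop :=
  exists2 c : R, 0 < c < 1 & forall (x : T) (r : R),
    0 < r -> (r%:E < diam [set: T])%E ->
    ball x r `\` ball x (c * r) !=set0.

(* Main.v *)
(* No measures are needed for the lower bounds. If W_i, of diameters r_i, cover
   E x F cheaply for the exponent s + t while F has no cheap cover for the
   exponent t, then for each x in E the projections to Y of those W_i that meet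
   {x} x Y cover F, so that the sum of r_i^t over these i is bounded below.
   Hence the projections to X with weights r_i^t form a fractional cover of E,
   and a Vitali argument turns it into a true cover with comparable s-cost.
   Doubling (from the finite Assouad dimension) and uniform perfectness serve
   only to bring diameters that are off by a constant factor back into
   [Phi delta, delta]. *)

Require Import Defs.
From mathcomp Require Import all_boot all_order all_algebra.
From mathcomp Require Import finmap.
From mathcomp Require Import all_classical all_reals all_analysis.
From mathcomp Require Import ring lra.

Set Implicit Arguments.
Unset Strict Implicit.
Unset Printing Implicit Defensive.

Import Order.TTheory GRing.Theory Num.Theory.
Import numFieldNormedType.Exports.

Local Open Scope classical_set_scope.
Local Open Scope ring_scope.

(** * Vitali selection and fractional covers *)

(** Choose a set with the largest [r], discard all sets that meet it, and recurse: every discarded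
    set meets a chosen one whose [r] is at least as large. *)
Lemma greedy_disjoint_subfamily (R : realType) (T : Type) (J : finType)
    (A : J -> set T) (r : J -> R) (P : {set J}) :
  exists G : {set J}, [/\ G \subset P,
    forall i j x, i \in G -> j \in G -> A i x -> A j x -> i = j &
    forall i x, i \in P -> A i x ->
      exists2 j, j \in G & r i <= r j /\ A i `&` A j !=set0].
Proof.
have [n] := ubnP #|P|; elim: n P => // n IHn P ltPn.
have [->|[i0 i0P]] := set_0Vmem P.
  exists finset.set0; split=> [|i j x|i x]; by rewrite ?sub0set ?inE.
case: (@Order.TotalTheory.arg_maxP _ _ _ i0 (mem P) r i0P) => i1 i1P i1max.
have {}i1P : i1 \in P by [].
have {}i1max j : j \in P -> r j <= r i1 by exact: i1max.
(* [i1] is removed explicitly: an empty [A i1] is disjoint from itself, so the filter alone would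
   keep it. *)
pose P' := [set i in P :\ i1 | `[< A i `&` A i1 = set0 >]]%SET.
have P'P : P' \subset P :\ i1 by apply/fintype.subsetP=> i; rewrite inE => /andP[].
have [G [GP' Gdisj Gcov]] : exists G : {set J}, [/\ G \subset P',
    forall i j x, i \in G -> j \in G -> A i x -> A j x -> i = j &
    forall i x, i \in P' -> A i x ->
      exists2 j, j \in G & r i <= r j /\ A i `&` A j !=set0].
  apply: IHn; apply: leq_ltn_trans (subset_leq_card P'P) _.
  by move: ltPn; rewrite (cardsD1 i1 P) i1P.
have Gi1 j x : j \in G -> A j x -> A i1 x -> False.
  move=> /(fintype.subsetP GP'); rewrite inE => /andP[_ /asboolP] AA Ajx Ai1x.
  by have : (A j `&` A i1) x by []; rewrite AA.
exists (i1 |: G)%SET; split=> [|i j x|i x iP Aix].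
- rewrite finset.subUset finset.sub1set i1P /=.
  apply: fintype.subset_trans GP' _; apply: fintype.subset_trans P'P _.
  exact: subsetDl.
- rewrite !inE => /predU1P[->|iG] /predU1P[->|jG] // Aix Ajx.
  + by have := Gi1 _ _ jG Ajx Aix.
  + by have := Gi1 _ _ iG Aix Ajx.
  + exact: Gdisj Ajx.
- have [iP'|] := boolP (i \in P').
    by have [j jG ?] := Gcov i x iP' Aix; exists j => //; rewrite !inE jG orbT.
  rewrite !inE iP andbT negb_and negbK => Hi.
  exists i1; first by rewrite !inE eqxx.
  split; first exact: i1max.
  case/orP: Hi => [/eqP eqi|/asboolPn /eqP /set0P //].
  by rewrite -eqi; exists x.
Qed.

(* If a fractional cover of E has cost S and total weight at least m at every
   point, removing from the weights a multiple of the indicator of a greedy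
   disjoint subfamily G lowers the total weight at a point by at most that
   multiple; if G costs more than S / m, the ratio cost / weight goes down. *)
Lemma weighted_cover (R : realType) (T : metricType R) (J : finType)
    (E : set T) (A : J -> set T) (r c w : J -> R) (m : R) :
  (forall j x y, A j x -> A j y -> mdist x y <= r j) ->
  (forall j, 0 <= c j) -> (forall j, 0 <= w j) -> 0 < m ->
  (forall x, E x -> m <= \sum_(j | `[< A j x >]) w j) ->
  exists G : {set J},
    (forall x, E x -> exists2 j, j \in G & exists2 y, A j y & mdist x y <= r j) /\
    m * \sum_(j in G) c j <= \sum_j w j * c j.
Proof.
move=> Ar c0; have [n] := ubnP #|[set j | 0 < w j]%SET|.
elim: n w m => // n IHn w m ltn w0 m0 Em.
set P := [set j | 0 < w j]%SET in ltn *.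
have [G [GP Gdisj Gcov]] := greedy_disjoint_subfamily A r P.
have Gcover x : E x -> exists2 j, j \in G & exists2 y, A j y & mdist x y <= r j.
  move=> /Em mx.
  have [i wi Aix] : exists2 i, 0 < w i & A i x.
    apply: contrapT => Hn.
    have : \sum_(j | `[< A j x >]) w j <= 0.
      apply: sumr_le0 => j /asboolP Ajx; rewrite leNgt; apply/negP => wj.
      by apply: Hn; exists j.
    lra.
  have [|j jG [rij [y [Aiy Ajy]]]] := Gcov i x _ Aix; first by rewrite inE.
  by exists j => //; exists y => //; apply: le_trans rij; apply: Ar Aiy.
have [|ltS] := leP (m * \sum_(j in G) c j) (\sum_j w j * c j).
  by move=> ?; exists G.
have [G0|[i0 i0G]] := set_0Vmem G.
  exists G; split=> //; rewrite {1}G0 big_set0 mulr0.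
  by apply: sumr_ge0 => j _; apply: mulr_ge0.
case: (@Order.TotalTheory.arg_minP _ _ _ i0 (mem G) w i0G) => i1 i1G i1min.
have {}i1G : i1 \in G by [].
have {}i1min j : j \in G -> w i1 <= w j by exact: i1min.
(* The least weight on [G] is the largest multiple of the indicator of [G] whose removal keeps all
   weights non-negative. The weight of [i1] drops to 0, so the induction on the number of positive
   weights applies. *)
set a := w i1.
have wGc : a * \sum_(j in G) c j <= \sum_j w j * c j.
  rewrite mulr_sumr [leLHS]big_mkcond; apply: ler_sum => j _.
  by case: ifPn => jG; [apply: ler_wpM2r (i1min _ jG)|apply: mulr_ge0].
have c_ge0 : 0 <= \sum_(j in G) c j by apply: sumr_ge0.
have am : a < m.
  rewrite ltNge; apply/negP => ma.
  by have := ler_wpM2r c_ge0 ma; lra.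
have a0 : 0 < a by have /(fintype.subsetP GP) := i1G; rewrite inE.
pose w' j := w j - a * (j \in G)%:R.
have w'0 j : 0 <= w' j.
  rewrite /w'; have [jG|_] := boolP (j \in G); rewrite ?mulr1 ?mulr0 ?subr0//.
  by rewrite subr_ge0 i1min.
have [|||G' [G'cov G'c]] := IHn w' (m - a) _ w'0 _.
- have /proper_card : ([set j | 0 < w' j]%SET \proper P).
    apply/properP; split.
      apply/fintype.subsetP => j; rewrite !inE => /lt_le_trans; apply.
      by rewrite lerBlDr lerDl mulr_ge0 // ltW.
    exists i1; first exact: (fintype.subsetP GP).
    by rewrite inE /w' i1G mulr1 subrr ltxx.
  by move=> /leq_trans; apply.
- by rewrite subr_gt0.
- move=> x Ex; rewrite /w' big_split /= sumrN -mulr_sumr lerB ?Em//.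
  rewrite ger_pMr// -natr_sum lern1.
  have -> : (\sum_(j | `[< A j x >]) (j \in G) =
      #|[pred j | `[< A j x >] & j \in G]|)%N.
    rewrite -sum1_card [LHS]big_mkcond [RHS]big_mkcond.
    by apply: eq_bigr => j _; rewrite !inE; case: asboolP; case: (j \in G).
  apply/card_le1_eqP => i j; rewrite !inE.
  by move=> /andP[/asboolP ? ?] /andP[/asboolP ? ?]; apply: Gdisj; eassumption.
exists G'; split=> //.
have eS : \sum_j w j * c j = \sum_j w' j * c j + a * \sum_(j in G) c j.
  rewrite mulr_sumr [X in _ + X]big_mkcond -big_split; apply: eq_bigr => j _.
  by rewrite /w' /=; case: (j \in G); rewrite ?mulr1 ?mulr0; ring.
move: G'c ltS; rewrite eS.
set S' := \sum_j w' j * c j; set Z := \sum_(j in G') c j.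
set Y := \sum_(j in G) c j in c_ge0 *.
move=> h1 h2.
(* From [S' + a * Y < m * Y] follows [S' <= (m - a) * Y], hence
   [m * S' <= (m - a) * (S' + a * Y)]. *)
have ma0 : 0 < m - a by lra.
by rewrite -(ler_pM2l ma0); have := ler_wpM2l (ltW m0) h1; nra.
Qed.

(** * Diameters and finite covers *)

Section Diameter.
Context {R : realType} {T : metricType R}.
Implicit Types (U : set T) (x y : T) (r : R).

Lemma le_diam U x y : U x -> U y -> ((mdist x y)%:E <= diam U)%E.
Proof.
by move=> Ux Uy; apply: ereal_sup_ubound; right; exists x => //; exists y.
Qed.

Lemma diam_le U r : 0 <= r -> (forall x y, U x -> U y -> mdist x y <= r) ->
  (diam U <= r%:E)%E.
Proof.
move=> r0 Ur; apply: ge_ereal_sup => _ [->|[x Ux [y Uy <-]]].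
  by rewrite lee_fin.
by rewrite lee_fin Ur.
Qed.

End Diameter.

(** Only the upper bounds [r j] of the diameters have to lie in [[a, b]]. Projections and products
    of covering sets thus give loose covers although their diameters are not controlled from below.
    The finite index type is what [weighted_cover] works with. *)
Definition loose_cover (R : realType) (T : metricType R) (a b s eps : R)
    (F : set T) : Prop :=
  exists (J : finType) (U : J -> set T) (r : J -> R),
    [/\ F `<=` \bigcup_j U j, forall j, a <= r j <= b,
        forall j x y, U j x -> U j y -> mdist x y <= r j &
        \sum_j r j `^ s <= eps].

Section Covers.
Context {R : realType} {T : metricType R}.
Implicit Types (F U : set T) (Phi : R -> R) (delta s eps : R).

(** A cover of finite cost is finite here, because every term of the sum is at least the [s]-th
    power of [Phi delta], which is positive. *)
Lemma has_cover_loose_cover Phi delta s eps F :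
  0 < Phi delta -> 0 <= s -> has_cover Phi delta s eps F ->
  loose_cover (Phi delta) delta s eps F.
Proof.
move=> P0 s0 [I [U [FU Idiam sumI]]].
pose r i := fine (diam (U i)).
have rE i : I i -> diam (U i) = (r i)%:E.
  move=> /Idiam /andP[h1 h2]; rewrite /r fineK// fin_numElt.
  by rewrite (lt_le_trans _ h1) ?ltNyr// (le_lt_trans h2) ?ltry.
have rP i : I i -> Phi delta <= r i <= delta.
  by move=> Ii; have := Idiam i Ii; rewrite rE// !lee_fin.
have sumfset (B : {fset nat}) : [set` B] `<=` I ->
    \sum_(i : B) r (val i) `^ s <= eps.
  move=> BI; rewrite -lee_fin; apply: le_trans sumI.
  apply: esum_ge; exists [set` B]; first by split=> //; exact: finite_fset.
  rewrite fsbig_finite ?finite_fset// set_fsetK big_seq_fsetE /= -sumEFin.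
  apply: lee_sum => i _; rewrite rE ?poweR_EFin//; apply: BI => /=.
  exact: fsvalP.
have finI : finite_set I.
  apply: contrapT => infI.
  have e0 : 0 <= eps.
    by rewrite -lee_fin; apply: le_trans sumI; apply: esum_ge0 => i _; exact: poweR_ge0.
  have q0 : 0 < Phi delta `^ s by exact: powR_gt0.
  have [B BI nB] := infinite_set_fset (Num.bound (eps / Phi delta `^ s)) infI.
  have := sumfset B BI; apply/negP; rewrite -ltNge.
  have : eps / Phi delta `^ s < #|` B|%:R.
    apply: (lt_le_trans (archi_boundP _)); last by rewrite ler_nat.
    by apply: divr_ge0 => //; exact: ltW.
  rewrite ltr_pdivrMr// => /lt_le_trans; apply.
  rewrite mulrC mulr_natr cardfE -sumr_const.
  apply: ler_sum => i _; have /andP[h _] := rP _ (BI _ (fsvalP i)).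
  apply: ge0_ler_powR => //; rewrite nnegrE; first exact: ltW.
  exact: le_trans (ltW P0) h.
have [B IB] := (finite_fsetP).1 finI.
exists B, (fun i => U (val i)), (fun i => r (val i)); split.
- move=> x /FU [i Ii Uix].
  have iB : i \in B by move: Ii; rewrite IB.
  by exists [` iB]%fset.
- by move=> i; apply: rP; rewrite IB; exact: fsvalP.
- move=> i x y Ux Uy; rewrite -lee_fin -rE ?le_diam// IB; exact: fsvalP.
- by apply: sumfset; rewrite IB.
Qed.

Lemma finite_cover_has_cover Phi delta s eps F (J : finType) (U : J -> set T)
    (q : J -> R) :
  0 <= s -> F `<=` \bigcup_j U j ->
  (forall j, ((Phi delta)%:E <= diam (U j) <= delta%:E)%E) ->
  (forall j, (diam (U j) <= (q j)%:E)%E) ->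
  \sum_j q j `^ s <= eps -> has_cover Phi delta s eps F.
Proof.
move=> s0 FU Uphi Uq sumq.
(* The empty set is a mere default, at numbers outside the index set. *)
exists [set` codom (@choice.pickle J)], (fun n => if choice.unpickle n is Some j then U j else set0).
split.
- move=> x /FU [j _ Ujx]; exists (choice.pickle j); first exact: codom_f.
  by rewrite choice.pickleK.
- by move=> _ /codomP [j ->]; rewrite choice.pickleK.
- rewrite esum_fset; [|exact: finite_seq|by move=> i _; exact: poweR_ge0].
  rewrite -fsbig_seq; last by rewrite map_inj_uniq ?enum_uniq//; exact: (pcan_inj choice.pickleK).
  rewrite big_map big_enum /=; apply: le_trans (_ : (\sum_j q j `^ s)%:E <= _)%E.
    rewrite -sumEFin; apply: lee_sum => j _; rewrite choice.pickleK -poweR_EFin.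
    apply: gt0_ler_poweR => //; rewrite ?in_itv /= ?leey ?andbT.
      by apply: ereal_sup_ubound; left.
    by apply: le_trans (Uq j); apply: ereal_sup_ubound; left.
  by rewrite lee_fin.
Qed.

End Covers.

(** * Bringing diameters back into the prescribed range *)

Section Normalization.
Context {R : realType} {T : metricType R}.
Implicit Types (F U : set T) (Phi : R -> R) (delta s eps : R).

(** A small-scale form of uniform perfectness that does not mention the diameter of the space, and
    so passes easily to products with a comparable metric. *)
Definition has_annuli (V : metricType R) : Prop :=
  exists L rho0 : R, [/\ 0 < L, 0 < rho0 &
    forall (x : V) r, 0 < r < rho0 -> exists y, r <= mdist x y <= L * r].

(** The number [M] depends on the ratio [Q] alone, not on the scale or on the set; the pieces are
    arbitrary sets since only their number and diameters matter. *)
Definition doubling F : Prop :=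
  forall Q : R, 0 < Q -> exists M : nat, forall rho (A : set T), 0 < rho ->
    A `<=` F -> (forall x y, A x -> A y -> mdist x y <= Q * rho) ->
    exists V : 'I_M -> set T, A `<=` \bigcup_j V j /\
      forall j x y, V j x -> V j y -> mdist x y <= rho.

(** A point of the ball of radius [r / c] outside the ball of radius [r] will do. This needs [r / c]
    below the diameter of the space, which the distance of two distinct points bounds from below. *)
Lemma uniformly_perfect_has_annuli :
  uniformly_perfect T -> (exists x x' : T, x <> x') -> has_annuli T.
Proof.
move=> [c /andP[c0 c1] Tc] [a [b /eqP ab]].
have D0 : 0 < mdist a b by rewrite mdist_gt0.
exists c^-1, (c * mdist a b); split; rewrite ?invr_gt0 ?mulr_gt0// => x r /andP[r0 rD].
have rc0 : 0 < r / c by rewrite divr_gt0.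
have [|y] := Tc x _ rc0.
  apply: (@lt_le_trans _ _ (mdist a b)%:E); last exact: le_diam.
  by rewrite lte_fin ltr_pdivrMr// mulrC.
rewrite !ballEmdist (mulrC c) divfK ?gt_eqF// => -[/= /ltW xy /negP].
by rewrite -leNgt => ryx; exists y; rewrite ryx mulrC.
Qed.

Lemma covering_number_lt F delta (c : R) : (covering_number delta F < c%:E)%E ->
  exists n (f : 'I_n -> T),
    n%:R < c /\ F `<=` \bigcup_i ball (f i) (delta / 2).
Proof.
by move=> /ereal_inf_lt [_ [n [f [_ Ff]] <-]]; rewrite lte_fin; exists n, f.
Qed.

Lemma ball_half_mdist (x : T) r y z :
  ball x (r / 2) y -> ball x (r / 2) z -> mdist y z <= r.
Proof.
rewrite !ballEmdist /= => xy xz.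
by have := metric_triangle y x z; rewrite (metric_sym y x); lra.
Qed.

(** A set of diameter at most [Q * rho] lies in the open ball of radius [(Q + 1) * rho] about any of
    its points, and balls of radius [rho / 2] have diameter at most [rho]. The extra 1 also makes
    the two radii of the Assouad bound strictly ordered. *)
Lemma assouad_doubling F : assouad_dim F \is a fin_num -> doubling F.
Proof.
rewrite fin_numElt => /andP[_ /ereal_inf_lt [_ [a [C C0 FC] <-] _]] Q Q0.
set c := C * (Q + 1) `^ a + 1.
have c_ge0 : 0 <= c by rewrite addr_ge0// mulr_ge0 ?powR_ge0// ltW.
exists (Num.bound c) => rho A rho0 AF Adiam.
have [->|/set0P [x Ax]] := eqVneq A set0.
  by exists (fun=> set0); split.
have [|n [f [nc ff]]] := @covering_number_lt (ball x ((Q + 1) * rho) `&` F) rho c.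
  apply: le_lt_trans (FC x rho ((Q + 1) * rho) (AF _ Ax) _) _.
    by rewrite rho0 ltr_pMl//; lra.
  by rewrite mulfK ?gt_eqF// lte_fin /c ltrDl.
(* The number [n] of balls varies with [A]; indices from [n] up to the uniform bound receive the
   empty set. *)
exists (fun j => [set y | exists2 i : 'I_n, i = j :> nat & ball (f i) (rho / 2) y]).
split=> [y Ay|j y z [i ij fy] [k kj]].
  have [|i _ fy] := ff y.
    split; last exact: AF.
    by rewrite ballEmdist /=; apply: le_lt_trans (Adiam _ _ Ax Ay) _; nra.
  have ltn : (i < Num.bound c)%N.
    apply: ltn_trans (ltn_ord i) _; rewrite -(ltr_nat R).
    exact: lt_trans nc (archi_boundP c_ge0).
  by exists (Ordinal ltn) => //; exists i.
have -> : k = i by apply: val_inj; rewrite /= ij kj.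
exact: ball_half_mdist.
Qed.

(** Adjoining one point at distance between [rho] and [L * rho] from a point of [P] pushes the
    diameter above [rho] and increases it by a bounded factor only. *)
Lemma fatten (L rho0 rho : R) (x0 : T) (P : set T) : 0 < L ->
  (forall (x : T) r, 0 < r < rho0 -> exists y, r <= mdist x y <= L * r) ->
  0 < rho < rho0 -> (forall x y, P x -> P y -> mdist x y <= rho) ->
  exists U : set T, P `<=` U /\ (rho%:E <= diam U <= ((1 + L) * rho)%:E)%E.
Proof.
move=> L0 annuli rho_bd Pdiam; have /andP[rho_gt0 _] := rho_bd.
(* An empty [P] is replaced by the singleton of [x0], to have a point to start from. *)
wlog [x Px] : P Pdiam / P !=set0.
  have [->|/set0P P0] := eqVneq P set0; last exact.
  move=> /(_ [set x0]) [|| U [_ ?]]; last by exists U; split.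
  - by move=> x y -> ->; rewrite mdistxx ltW.
  - by exists x0.
have [y /andP[rxy xyL]] := annuli x rho rho_bd.
exists (P `|` [set y]); split; first by move=> z Pz; left.
apply/andP; split.
  apply: (@le_trans _ _ (mdist x y)%:E); first by rewrite lee_fin.
  by apply: le_diam; [left|right].
have Py z : P z -> mdist z y <= (1 + L) * rho.
  by move=> Pz; have := metric_triangle z x y; have := Pdiam _ _ Pz Px; lra.
have LR : 0 < (1 + L) * rho by apply: mulr_gt0 => //; lra.
apply: diam_le; first exact: ltW.
move=> z w [Pz|->] [Pw|->].
- by have := Pdiam _ _ Pz Pw; nra.
- exact: Py.
- by rewrite metric_sym Py.
- by rewrite mdistxx ltW.
Qed.

Lemma admissible_near0 (Delta : R) Phi (k : R) : admissible Delta Phi -> 0 < k ->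
  exists delta1, [/\ 0 < delta1 <= 1, delta1 <= Delta &
    forall delta, 0 < delta < delta1 -> 0 < Phi delta <= k * delta].
Proof.
move=> [Delta0 _ PhiP Philim] k0.
have := cvgr0_norm_lt (fun delta : R => Phi delta / delta) Philim k k0.
case=> [e /= e0 He].
exists (Num.min e (Num.min 1 Delta)); split.
- by rewrite !lt_min !ge_min e0 Delta0 ltr01 lexx orbT.
- by rewrite !ge_min lexx !orbT.
move=> delta; rewrite !lt_min => /andP[d0 /and3P[de d1 dD]].
have /andP[P0 _] : 0 < Phi delta <= delta by apply: PhiP; rewrite d0.
rewrite P0 /= -ler_pdivrMr//.
have := He delta; rewrite /ball_ /= sub0r normrN gtr0_norm// => /(_ de d0).
by rewrite ger0_norm ?divr_ge0 ?(ltW P0) ?(ltW d0)// => /ltW.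
Qed.

(** Each bound [r j] is truncated to [rho j], at most [k * delta]; each set is cut by doubling into
    [M] pieces of diameter at most [rho j]; each piece is fattened to a diameter between [rho j] and
    [(1 + L) * rho j]. Since [Phi delta <= k * delta] for small [delta], the result lies in the
    prescribed range. *)
Lemma loose_cover_has_cover F (Delta : R) Phi (K s : R) :
  admissible Delta Phi -> has_annuli T -> doubling F -> F !=set0 ->
  0 < K -> 0 <= s ->
  exists C delta1 : R, [/\ 0 < C, 0 < delta1 & forall delta eps,
    0 < delta < delta1 -> loose_cover (Phi delta) (K * delta) s eps F ->
    has_cover Phi delta s (C * eps) F].
Proof.
move=> admPhi [L [rho0 [L0 rho00 annuli]]] dblF [x0 _] K0 s0.
(* With this [k], fattening a set of diameter at most [k * delta] does not exceed [delta]. *)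
set k := (1 + L)^-1; have L1 : 0 < 1 + L by lra.
have k0 : 0 < k by rewrite invr_gt0.
have k1 : k <= 1 by rewrite invf_le1//; lra.
have kL : (1 + L) * k = 1 by rewrite mulfV ?gt_eqF.
have [d2 [/andP[d20 _] _ Phik]] := admissible_near0 admPhi k0.
(* The ratio of [r j] to [rho j] is 1 without truncation and otherwise at most [K / k], that is
   [K * (1 + L)]. *)
set Q := Num.max 1 (K * (1 + L)).
have [|M HM] := dblF Q; first by rewrite lt_max ltr01.
(* The successor keeps the constant positive when [M] is 0. *)
exists (M.+1%:R * (1 + L) `^ s), (Num.min d2 rho0); split.
- by rewrite mulr_gt0 ?powR_gt0.
- by rewrite lt_min d20.
move=> delta eps; rewrite lt_min => /andP[d0 /andP[dd2 drho0]].
move=> [J [U [r [FU rP Udiam sumr]]]].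
have /andP[P0 Pk] : 0 < Phi delta <= k * delta by apply: Phik; rewrite d0.
pose rho j := Num.min (r j) (k * delta).
have r_gt0 j : 0 < r j by have /andP[h _] := rP j; exact: lt_le_trans h.
have kd0 : 0 < k * delta by rewrite mulr_gt0.
have kd1 : k * delta <= delta by rewrite ler_piMl// ltW.
have rho_gt0 j : 0 < rho j by rewrite lt_min r_gt0.
have Prho j : Phi delta <= rho j by rewrite le_min Pk andbT; have /andP[] := rP j.
have rhor j : rho j <= r j by rewrite ge_min lexx.
have rhok j : rho j <= k * delta by rewrite ge_min lexx orbT.
have rQ j : r j <= Q * rho j.
  rewrite /rho; case: (leP (r j) (k * delta)) => _.
    by rewrite ler_peMl ?(ltW (r_gt0 j))// le_max lexx.
  have /andP[_ rK] := rP j; apply: le_trans rK _.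
  have : K * (1 + L) <= Q by rewrite le_max lexx orbT.
  move=> /(ler_wpM2r (ltW kd0)); apply: le_trans.
  by rewrite mulrA -(mulrA K) kL mulr1.
have /choice [V VP] : forall j, exists V : 'I_M -> set T,
    U j `&` F `<=` \bigcup_i V i /\
    forall i x y, V i x -> V i y -> mdist x y <= rho j.
  move=> j; apply: HM => // x y [Ux _] [Uy _].
  exact: le_trans (Udiam _ _ _ Ux Uy) (rQ j).
have /choice [W WP] : forall p : J * 'I_M, exists W : set T, V p.1 p.2 `<=` W /\
    ((rho p.1)%:E <= diam W <= ((1 + L) * rho p.1)%:E)%E.
  move=> [j i]; apply: (fatten x0 L0 annuli).
    by rewrite rho_gt0 /=; apply: le_lt_trans (rhok j) _; exact: le_lt_trans drho0.
  exact: (VP j).2.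
apply: (@finite_cover_has_cover _ _ _ _ _ _ _ (J * 'I_M)%type W
   (fun p => (1 + L) * rho p.1)) => //.
- move=> x Fx; have [j _ Ujx] := FU x Fx.
  have [i _ Vx] := (VP j).1 x (conj Ujx Fx).
  by exists (j, i) => //; apply: (WP (j, i)).1.
- move=> p; have /andP[h1 h2] := (WP p).2; apply/andP; split.
    by apply: le_trans h1; rewrite lee_fin.
  apply: le_trans h2 _; rewrite lee_fin.
  have := ler_wpM2l (ltW L1) (rhok p.1).
  by rewrite mulrA kL mul1r.
- by move=> p; have /andP[] := (WP p).2.
rewrite -(pair_bigA _ (fun j (i : 'I_M) => ((1 + L) * rho j) `^ s)) /=.
under eq_bigr do rewrite sumr_const card_ord powRM ?(ltW L1) ?(ltW (rho_gt0 _))//.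
rewrite sumrMnl -mulr_sumr -(mulr_natl (_ * _)) -[leRHS]mulrA.
have S_ge0 : 0 <= \sum_j rho j `^ s by apply: sumr_ge0 => j _; exact: powR_ge0.
have Se : \sum_j rho j `^ s <= eps.
  apply: le_trans sumr; apply: ler_sum => j _.
  by apply: ge0_ler_powR; rewrite ?nnegrE ?(ltW (rho_gt0 j)) ?(ltW (r_gt0 j)).
apply: ler_pM => //; rewrite ?mulr_ge0 ?powR_ge0 ?ler_nat//.
by apply: ler_wpM2l => //; exact: powR_ge0.
Qed.

End Normalization.

(** * Covers of products and of their factors *)

Lemma gt0_powRD (R : realType) (x r s : R) : 0 < x ->
  x `^ (r + s) = x `^ r * x `^ s.
Proof. by move=> x0; rewrite powRD// (gt_eqF x0) implybT. Qed.

Section Product.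
Context {R : realType} {X Y : metricType R}.
Context {d : X * Y -> X * Y -> R} (hd : is_metric d).
Context (dmax : comparable_to_max d).
Implicit Types (E : set X) (F : set Y) (Phi : R -> R).

Local Notation XY := (metrized hd : metricType R).

Lemma comparable_mdist : exists c1 c2 : R, [/\ 0 < c1, 0 < c2 &
  forall p q : XY, [/\ c1 * mdist p.1 q.1 <= mdist p q,
    c1 * mdist p.2 q.2 <= mdist p q &
    forall r, mdist p.1 q.1 <= r -> mdist p.2 q.2 <= r -> mdist p q <= c2 * r]].
Proof.
have [c1 [c2 [c10 c20 H]]] := dmax.
exists c1, c2; split=> // -[x y] [x' y']; have /andP[h1 h2] := H x x' y y'.
split=> /=; rewrite ?mdist_metrized.
- by apply: le_trans h1; rewrite ler_pM2l// le_max lexx.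
- by apply: le_trans h1; rewrite ler_pM2l// le_max lexx orbT.
- by move=> r xr yr; apply: le_trans h2 _; rewrite ler_pM2l// ge_max xr.
Qed.

(** Only the first coordinate is moved, by at least [r / c1] to make up for the lower comparison
    constant. *)
Lemma product_has_annuli : has_annuli X -> has_annuli XY.
Proof.
move=> [L [rho0 [L0 rho00 annuli]]].
have [c1 [c2 [c10 c20 dP]]] := comparable_mdist.
exists (c2 * (L / c1)), (c1 * rho0); split; rewrite ?mulr_gt0 ?invr_gt0//.
move=> [x y] r /andP[r0 rrho].
have [|x' /andP[h1 h2]] := annuli x (r / c1).
  by rewrite divr_gt0//= ltr_pdivrMr// mulrC.
exists (x', y); have [H1 _ H2] := dP (x, y) (x', y); apply/andP; split.
  by apply: le_trans H1; rewrite mulrC -ler_pdivrMr.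
rewrite -mulrA -(mulrA L) (mulrC c1^-1); apply: H2 => //=.
rewrite mdistxx; apply: mulr_ge0; first exact: ltW.
by apply: divr_ge0; exact: ltW.
Qed.

Lemma product_doubling E F : doubling E -> doubling F ->
  doubling (E `*` F : set XY).
Proof.
move=> dblE dblF Q Q0; have [c1 [c2 [c10 c20 dP]]] := comparable_mdist.
(* Projections have diameter at most [Q * rho / c1], and pieces of diameter [rho / c2] in both
   factors combine to diameter [rho]; the ratio of the two is this constant. *)
have Q'0 : 0 < Q * c2 / c1 by rewrite divr_gt0 ?mulr_gt0.
have [M HM] := dblE _ Q'0; have [N HN] := dblF _ Q'0.
exists #|{: 'I_M * 'I_N}| => rho A rho0 AEF Adiam.
have rho'0 : 0 < rho / c2 by rewrite divr_gt0.
have eQ : Q * c2 / c1 * (rho / c2) = Q * rho / c1.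
  by field; rewrite !gt_eqF.
have [|x y [p Ap <-] [q Aq <-]|U [AU Udiam]] := HM _ (fst @` A) rho'0.
- by move=> _ [p /AEF [] ? _ <-].
- have [h _ _] := dP p q; have := Adiam _ _ Ap Aq.
  by rewrite eQ ler_pdivlMr// (mulrC _ c1); exact: le_trans h.
have [|x y [p Ap <-] [q Aq <-]|V [AV Vdiam]] := HN _ (snd @` A) rho'0.
- by move=> _ [p /AEF [] _ ? <-].
- have [_ h _] := dP p q; have := Adiam _ _ Ap Aq.
  by rewrite eQ ler_pdivlMr// (mulrC _ c1); exact: le_trans h.
exists (fun k => U (enum_val k).1 `*` V (enum_val k).2); split.
  move=> p Ap; have [i _ Ui] := AU p.1 (ex_intro2 _ _ p Ap erefl).
  have [j _ Vj] := AV p.2 (ex_intro2 _ _ p Ap erefl).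
  by exists (enum_rank (i, j)) => //; rewrite enum_rankK.
move=> k p q [Up Vp] [Uq Vq]; have [_ _ h] := dP p q.
have -> : rho = c2 * (rho / c2) by rewrite mulrC divfK ?gt_eqF.
by apply: h; [exact: Udiam Up Uq|exact: Vdiam Vp Vq].
Qed.

(* Weight the projection to X of a set of diameter r by r^t: at each point x of
   E the total weight is at least a constant times eta, because the sets meeting
   the fibre over x cover F; weighted_cover then yields a cover of E. *)
Lemma product_cover_fst E F (Delta : R) Phi (s t u : R) :
  admissible Delta Phi -> has_annuli X -> has_annuli Y ->
  doubling E -> doubling F -> E !=set0 -> F !=set0 ->
  0 <= s -> 0 <= t -> 0 <= u <= s + t ->
  exists C delta1 : R, [/\ 0 < C, 0 < delta1 & forall delta eps eta,
    0 < delta < delta1 -> 0 < eta ->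
    has_cover Phi delta u eps (E `*` F : set XY) ->
    ~ has_cover Phi delta t eta F -> has_cover Phi delta s (C * eps / eta) E].
Proof.
move=> admPhi annX annY dblE dblF E0 F0 s0 t0 /andP[u0 ust].
have [c1 [c2 [c10 c20 dP]]] := comparable_mdist.
(* The bound [K >= c1^-1] controls the diameters of projections by [K * r j], and [K >= 1] keeps
   this above [Phi delta]. *)
set K := Num.max 1 c1^-1.
have K1 : 1 <= K by rewrite le_max lexx.
have K0 : 0 < K by lra.
(* The cover of [E] consists of neighbourhoods of radius [rho j] of sets of diameter at most
   [rho j], hence the factor 3. *)
have K3 : 0 < 3 * K by lra.
have Kc : c1^-1 <= K by rewrite le_max lexx orbT.
have [CF [dF [CF0 dF0 coverF]]] := loose_cover_has_cover admPhi annY dblF F0 K0 t0.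
have [CE [dE [CE0 dE0 coverE]]] := loose_cover_has_cover admPhi annX dblE E0 K3 s0.
have [dP' [/andP[dP0 dP1] _ Phi0]] := admissible_near0 admPhi ltr01.
exists (CE * (3 `^ s * K `^ (s + t) * CF)), (Num.min dP' (Num.min dF dE)); split.
- by rewrite !mulr_gt0 ?powR_gt0.
- by rewrite !lt_min dP0 dF0.
move=> delta eps eta; rewrite !lt_min => /andP[d0 /and3P[ddP ddF ddE]] eta0 cov ncov.
have /andP[P0 _] : 0 < Phi delta <= 1 * delta by apply: Phi0; rewrite d0.
have [J [W [r [EFW rP Wdiam sumr]]]] := has_cover_loose_cover P0 u0 cov.
have r_gt0 j : 0 < r j by have /andP[h _] := rP j; exact: lt_le_trans h.
pose rho j := K * r j.
have rho_gt0 j : 0 < rho j by rewrite mulr_gt0.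
have rhoP j : Phi delta <= rho j <= K * delta.
  have /andP[h1 h2] := rP j; rewrite ler_pM2l// h2 andbT.
  by apply: le_trans h1 _; rewrite ler_peMl// ltW.
have rho_proj j z : c1 * z <= r j -> z <= rho j.
  move=> cz; have : z <= c1^-1 * r j by rewrite mulrC ler_pdivlMr// mulrC.
  by move/le_trans; apply; rewrite ler_pM2r.
have Adiam j x x' : (fst @` W j) x -> (fst @` W j) x' -> mdist x x' <= rho j.
  move=> [p Wp <-] [q Wq <-]; have [h _ _] := dP p q.
  by apply: rho_proj; apply: le_trans h _; exact: Wdiam.
have Bdiam j y y' : (snd @` W j) y -> (snd @` W j) y' -> mdist y y' <= rho j.
  move=> [p Wp <-] [q Wq <-]; have [_ h _] := dP p q.
  by apply: rho_proj; apply: le_trans h _; exact: Wdiam.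
(* A loose cover of [F] of cost [eta / CF] would be normalized to one of cost [eta], which [ncov]
   excludes. *)
have m0 : 0 < eta / CF by rewrite divr_gt0.
have [j|j|x Ex|G [GE Gsum]] := @weighted_cover R X J E (fun j => fst @` W j) rho
    (fun j => rho j `^ s) (fun j => rho j `^ t) (eta / CF) Adiam _ _ m0 _.
- exact: powR_ge0.
- exact: powR_ge0.
- rewrite leNgt; apply/negP => sumlt; apply: ncov.
  have -> : eta = CF * (eta / CF) by rewrite mulrC divfK ?gt_eqF.
  apply: coverF; first by rewrite d0.
  exists {j | `[< (fst @` W j) x >]}, (fun j => snd @` W (val j)), (rho \o val).
  split=> [y Fy|j|j|] //=.
  + have [j _ Wj] := EFW (x, y) (conj Ex Fy).
    have xj : `[< (fst @` W j) x >] by apply/asboolP; exists (x, y).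
    by exists (exist _ j xj) => //; exists (x, y).
  + exact: Bdiam.
  + by rewrite -(big_sub _ (fun j => rho j `^ t)) ltW.
have -> : CE * (3 `^ s * K `^ (s + t) * CF) * eps / eta =
    CE * (3 `^ s * (K `^ (s + t) * eps / (eta / CF))).
  by field; rewrite !gt_eqF.
apply: coverE; first by rewrite d0.
exists {j | j \in G},
  (fun j => [set x | exists2 y, (fst @` W (val j)) y & mdist x y <= rho (val j)]),
  (fun j => 3 * rho (val j)); split.
- by move=> x /GE [j jG ?]; exists (exist _ j jG).
- move=> j; have /andP[h1 h2] := rhoP (val j); have := rho_gt0 (val j).
  by move=> ?; apply/andP; split; lra.
- move=> j x x' [y Wy xy] [y' Wy' xy'].
  have := Adiam _ _ _ Wy Wy'; have := metric_triangle x y x'.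
  by have := metric_triangle y y' x'; rewrite (metric_sym y' x'); lra.
rewrite -(big_sub (mem G) (fun j => (3 * rho j) `^ s)).
under eq_bigr do rewrite powRM ?(ltW (rho_gt0 _))//.
rewrite -mulr_sumr ler_pM2l ?powR_gt0// ler_pdivlMr// mulrC.
apply: le_trans Gsum _.
apply: (@le_trans _ _ (\sum_j K `^ (s + t) * r j `^ u)); last first.
  by rewrite -mulr_sumr ler_pM2l ?powR_gt0.
apply: ler_sum => j _.
rewrite mulrC -gt0_powRD//.
rewrite /rho powRM ?(ltW K0) ?(ltW (r_gt0 j))// ler_pM2l ?powR_gt0//.
(* Here [r j <= delta < 1], so passing from the exponent [s + t] to the smaller [u] increases the
   power. *)
apply: ger_powR => //; rewrite r_gt0 /=.
by have /andP[_ h] := rP j; apply: le_trans h _; apply: le_trans (ltW ddP) _.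
Qed.

(** Each set of diameter [r j] in the cover of [E] is multiplied by the balls of a cover of [F] at
    the same scale [r j]. There are fewer than the [-t]-th power of [r j] of them, so their joint
    cost for [s + t] is, up to a constant, the [s]-th power of [r j]. *)
Lemma product_cover_box E F (Delta : R) Phi (s t r0 : R) :
  admissible Delta Phi -> has_annuli X ->
  doubling E -> doubling F -> E !=set0 -> F !=set0 ->
  0 <= s -> 0 <= t -> 0 < r0 ->
  (forall r, 0 < r < r0 -> (covering_number r F < (r `^ (- t))%:E)%E) ->
  exists C delta1 : R, [/\ 0 < C, 0 < delta1 & forall delta eps,
    0 < delta < delta1 -> has_cover Phi delta s eps E ->
    has_cover Phi delta (s + t) (C * eps) (E `*` F : set XY)].
Proof.
move=> admPhi annX dblE dblF [x0 Ex0] [y0 Fy0] s0 t0 r00 covF.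
have [c1 [c2 [c10 c20 dP]]] := comparable_mdist.
set K := Num.max 1 c2.
have K1 : 1 <= K by rewrite le_max lexx.
have K0 : 0 < K by lra.
have Kc : c2 <= K by rewrite le_max lexx orbT.
have st0 : 0 <= s + t by rewrite addr_ge0.
have [C [d1 [C0 d10 cover]]] := loose_cover_has_cover admPhi (product_has_annuli annX)
  (product_doubling dblE dblF) (ex_intro _ ((x0, y0) : XY) (conj Ex0 Fy0)) K0 st0.
have [dP' [/andP[dP0 dP1] _ Phi0]] := admissible_near0 admPhi ltr01.
exists (C * K `^ (s + t)), (Num.min dP' (Num.min r0 d1)); split.
- by rewrite mulr_gt0 ?powR_gt0.
- by rewrite !lt_min dP0 r00.
move=> delta eps; rewrite !lt_min => /andP[d0 /and3P[ddP dr0 dd1]] cov.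
have /andP[P0 _] : 0 < Phi delta <= 1 * delta by apply: Phi0; rewrite d0.
have [J [U [r [EU rP Udiam sumr]]]] := has_cover_loose_cover P0 s0 cov.
have r_gt0 j : 0 < r j by have /andP[h _] := rP j; exact: lt_le_trans h.
have /choice [N NP] : forall j, exists n, exists f : 'I_n -> Y,
    n%:R < r j `^ (- t) /\ F `<=` \bigcup_i ball (f i) (r j / 2).
  move=> j; apply: covering_number_lt; apply: covF; rewrite r_gt0 /=.
  by have /andP[_ h] := rP j; exact: le_lt_trans dr0.
pose f j := sval (cid (NP j)).
have fP j : (N j)%:R < r j `^ (- t) /\ F `<=` \bigcup_i ball (f j i) (r j / 2).
  exact: svalP (cid (NP j)).
rewrite -mulrA; apply: cover; first by rewrite d0.
(* The number of balls depends on [j], so the index type is a dependent sum. *)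
exists {j : J & 'I_(N j)},
  (fun p => U (tag p) `*` ball (f (tag p) (tagged p)) (r (tag p) / 2)),
  (fun p => K * r (tag p)); split.
- move=> [x y] [Ex Fy]; have [j _ Ux] := EU x Ex.
  by have [i _ fy] := (fP j).2 y Fy; exists (Tagged (fun j => 'I_(N j)) i).
- move=> [j i] /=; have /andP[h1 h2] := rP j; rewrite ler_pM2l// h2 andbT.
  by apply: le_trans h1 _; rewrite ler_peMl// ltW.
- move=> [j i] p q [/= Up Vp] [Uq Vq]; have [_ _ h] := dP p q.
  apply: (@le_trans _ _ (c2 * r j)); last by rewrite ler_pM2r.
  by apply: h; [exact: Udiam Up Uq|exact: ball_half_mdist Vp Vq].
have -> : \sum_(p : {j : J & 'I_(N j)}) (K * r (tag p)) `^ (s + t) =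
    \sum_j \sum_(i < N j) (K * r j) `^ (s + t).
  by rewrite (sig_big_dep _ _ (fun j (i : 'I_(N j)) => (K * r j) `^ (s + t))).
apply: (@le_trans _ _ (\sum_j K `^ (s + t) * r j `^ s)); last first.
  by rewrite -mulr_sumr ler_pM2l ?powR_gt0.
apply: ler_sum => j _; rewrite sumr_const card_ord -(mulr_natl (_ `^ _)).
rewrite powRM ?(ltW K0) ?(ltW (r_gt0 j))// mulrCA ler_pM2l ?powR_gt0//.
have [/ltW Nr _] := fP j.
rewrite gt0_powRD// mulrCA ler_piMr ?powR_ge0//.
apply: le_trans (ler_wpM2r (powR_ge0 _ _) Nr) _.
by rewrite -gt0_powRD// addNr powRr0.
Qed.

End Product.

(** * Sums of infima of sets of exponents *)

Section Infima.
Context {R : realType}.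
Implicit Types (A B P : set R) (b : \bar R).

Lemma ereal_inf_ge0 A : (forall x, A x -> 0 <= x) ->
  (0 <= ereal_inf [set x%:E | x in A])%E.
Proof. by move=> A0; apply: le_ereal_inf_tmp => _ [x /A0 x0 <-]; rewrite lee_fin. Qed.

Lemma lt_ereal_inf_not A x : (x%:E < ereal_inf [set x%:E | x in A])%E -> ~ A x.
Proof.
by move=> + Ax; apply/negP; rewrite -leNgt; apply: ereal_inf_lbound; exists x.
Qed.

(** [A], [B] and [P] stand for the exponents of [E], [F] and the product. If the inequality failed
    at some [u] in [P], there would be [t] below the infimum of [B] with [u - t] below the infimum
    of [A]; but [t] is not in [B], so [u - t] is in [A]. *)
Lemma ereal_inf_add_le A B P :
  (forall s, A s -> 0 <= s) -> ~ A 0 -> ~ B 0 -> (forall u, P u -> 0 <= u) ->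
  (forall u s t, P u -> 0 <= s -> 0 <= t -> u <= s + t -> ~ B t -> A s) ->
  (ereal_inf [set x%:E | x in A] + ereal_inf [set x%:E | x in B] <=
    ereal_inf [set x%:E | x in P])%E.
Proof.
move=> A0 nA0 nB0 P0 H; apply: le_ereal_inf_tmp => _ [u Pu <-].
(* Taking [t] to be 0, which is not in [B], shows that [A] is non-empty, so its infimum is
   finite. *)
have Au : A u by apply: (H u u 0); rewrite ?addr0//; exact: P0.
set a := ereal_inf [set x%:E | x in A].
have au : (a <= u%:E)%E by apply: ereal_inf_lbound; exists u.
have age0 : (0 <= a)%E := ereal_inf_ge0 A0.
have afin : a \is a fin_num.
  by rewrite fin_numElt (lt_le_trans _ age0) ?ltNyr// (le_lt_trans au) ?ltry.
have alb s : A s -> fine a <= s.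
  by move=> As; rewrite -lee_fin fineK//; apply: ereal_inf_lbound; exists s.
have aufin : fine a <= u := alb u Au.
rewrite -(fineK afin) addeC -leeBrDr// -EFinB leNgt; apply/negP => ltB.
have [t ut tB] : exists2 t, u - fine a < t & (t%:E < ereal_inf [set x%:E | x in B])%E.
  case: (ereal_inf [set x%:E | x in B]) ltB => [b| |] //=.
    rewrite lte_fin => ltb; exists ((u - fine a + b) / 2); first by lra.
    by rewrite lte_fin; lra.
  by move=> _; exists (u - fine a + 1); rewrite ?ltry//; lra.
have nBt := lt_ereal_inf_not tB.
have t0 : 0 <= t by lra.
(* When [u - t] is not positive, 0 takes its place and would belong to [A]. *)
have [tu|ut'] := leP u t.
  by apply: nA0; apply: (H u 0 t); rewrite ?add0r.
have := alb (u - t) (H u (u - t) t Pu _ t0 _ nBt); lra.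
Qed.

Lemma ereal_inf_le_add A P b : (0 <= b)%E -> (forall s, A s -> 0 <= s) ->
  (forall s t, A s -> (b < t%:E)%E -> P (s + t)) ->
  (ereal_inf [set x%:E | x in P] <= ereal_inf [set x%:E | x in A] + b)%E.
Proof.
move=> b0 A0 H; have := ereal_inf_ge0 A0.
case E : (ereal_inf [set x%:E | x in A]) => [a| |] // _; last first.
  by rewrite addye ?leey//; case: b b0 {H}.
case: b b0 H => [b| |] // b0 H; last by rewrite addey ?leey.
apply/lee_addgt0Pr => e e0; have e20 : 0 < e / 2 by lra.
have [|_ [s As <-]] := @ereal_inf_lt R [set x%:E | x in A] (a + e / 2)%:E.
  by rewrite E lte_fin ltrDl.
rewrite lte_fin => sa; apply: le_trans (ereal_inf_lbound _) _.
  by exists (s + (b + e / 2)) => //; apply: H => //; rewrite lte_fin ltrDl.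
by rewrite -!EFinD lee_fin; lra.
Qed.

End Infima.

(** * Box dimension and covering numbers at small scales *)

Section BoxDimension.
Context {R : realType} {T : metricType R}.
Implicit Types F : set T.

Lemma covering_number_ge0 r F : (0 <= covering_number r F)%E.
Proof. by apply: le_ereal_inf_tmp => _ [n _ <-]; rewrite lee_fin. Qed.

Lemma covering_number_ge1 r F : F !=set0 -> (1 <= covering_number r F)%E.
Proof.
move=> [x Fx]; apply: le_ereal_inf_tmp => _ [n [f [_ Ff]] <-].
by have [i _ _] := Ff x Fx; rewrite lee_fin ler1n; case: n i {f Ff} => [[]|].
Qed.

Lemma upper_box_dim_ge0 F : F !=set0 -> (0 <= upper_box_dim F)%E.
Proof.
move=> F0; rewrite /upper_box_dim limf_esupE.
apply: le_ereal_inf_tmp => _ [V V0 <-].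
have [r [Vr r1 r0]] : exists r, [/\ V r, r < 1 & 0 < r].
  have : \forall r \near 0^'+, [/\ V r, r < 1 & 0 < r :> R].
    near=> r; split; last by near: r; exact: nbhs_right_gt.
      by near: r; exact: V0.
    by near: r; exact: nbhs_right_lt.
  exact: filter_ex.
apply: le_ereal_sup_tmp; exists (lne (covering_number r F) / (- ln r)%:E)%E.
  by exists r.
apply: mule_ge0; first by rewrite lne_ge0 covering_number_ge1.
by rewrite inve_ge0 lee_fin oppr_ge0 ln_le0 ?ltW.
Unshelve. all: by end_near. Qed.

Lemma upper_box_dim_lt F t : (upper_box_dim F < t%:E)%E ->
  exists2 r0 : R, 0 < r0 &
    forall r, 0 < r < r0 -> (covering_number r F < (r `^ (- t))%:E)%E.
Proof.
rewrite /upper_box_dim limf_esupE => /ereal_inf_lt [_ [V V0 <-] ltV].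
(* Below 1 the number [- ln r] is positive, so the inequality of quotients can be multiplied by
   it. *)
case: V0 => e /= e0 He; exists (Num.min e 1); first by rewrite lt_min e0 ltr01.
move=> r; rewrite lt_min => /andP[r0 /andP[re r1]].
have Vr : V r by apply: He => //; rewrite /ball_ /= sub0r normrN gtr0_norm.
have ln0 : 0 < - ln r by rewrite oppr_gt0 ln_lt0 ?r0.
have : (lne (covering_number r F) / (- ln r)%:E < t%:E)%E.
  by apply: le_lt_trans ltV; apply: ereal_sup_ubound; exists r.
rewrite inver (gt_eqF ln0) lte_pdivrMr// => ltN; rewrite ltNge; apply/negP => leN.
move: ltN; apply/negP; rewrite -leNgt.
have -> : (t%:E * (- ln r)%:E)%E = lne (r `^ (- t))%:E.
  by rewrite lne_EFin ?powR_gt0// ln_powR -EFinM mulrN mulNr.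
by rewrite lee_lne// in_itv /= leey andbT ?covering_number_ge0// lee_fin powR_ge0.
Qed.

End BoxDimension.

(** * Exponents of the factors and of the product *)

Section Exponents.
Context {R : realType} (Delta : R) (Phi : R -> R).
Context (admPhi : admissible Delta Phi).
Implicit Types (T X Y : metricType R).

(** The set whose infimum [upper_intermediate_dim] is by definition, named so that membership can be
    reasoned about. *)
Definition upper_exponent T (F : set T) : set R := [set s | 0 <= s /\
  forall eps : R, 0 < eps ->
    exists delta0 : R, [/\ 0 < delta0 <= 1, delta0 <= Delta &
      forall delta, 0 < delta < delta0 -> has_cover Phi delta s eps F]].

Definition lower_exponent T (F : set T) : set R := [set s | 0 <= s /\
  forall eps delta0 : R, 0 < eps -> 0 < delta0 <= 1 ->
    exists delta, [/\ 0 < delta < delta0, delta < Delta &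
      has_cover Phi delta s eps F]].

(** For the exponent 0 the cost counts the sets, so it is at least 1. This keeps 0 out of the sets
    of exponents, as [ereal_inf_add_le] demands. *)
Lemma not_has_cover0 T (F : set T) (delta : R) : F !=set0 -> 0 < Phi delta ->
  ~ has_cover Phi delta 0 (1 / 2) F.
Proof.
move=> [x Fx] P0 /(has_cover_loose_cover P0 (lexx 0)) [J [U [r [FU _ _]]]].
have [j _ _] := FU x Fx.
under eq_bigr do rewrite powRr0.
rewrite sumr_const => leJ.
have : 1 <= #|J|%:R :> R by rewrite ler1n; apply/card_gt0P; exists j.
by move: leJ; lra.
Qed.

Lemma lower_exponent_gt0 T (F : set T) : F !=set0 -> ~ lower_exponent F 0.
Proof.
move=> F0 [_ F_cov]; have half0 : 0 < 1 / 2 :> R by lra.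
have [_ _ PhiP _] := admPhi.
have [|delta [/andP[d0 _] dD cov]] := F_cov (1 / 2) 1 half0; first by rewrite ltr01 lexx.
apply: not_has_cover0 cov => //.
by have /andP[] : 0 < Phi delta <= delta by apply: PhiP; rewrite d0.
Qed.

Lemma upper_lower_exponent T (F : set T) : upper_exponent F `<=` lower_exponent F.
Proof.
move=> s [s0 F_cov]; split=> // eps delta0 eps0 /andP[d00 d01].
have [d [/andP[d_gt0 d1] dD cov]] := F_cov eps eps0.
have m0 : 0 < Num.min d delta0 by rewrite lt_min d_gt0.
have md : Num.min d delta0 <= d by rewrite ge_min lexx.
have md0 : Num.min d delta0 <= delta0 by rewrite ge_min lexx orbT.
exists (Num.min d delta0 / 2); split; [apply/andP; split| |apply: cov; apply/andP; split]; lra.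
Qed.

Lemma not_upper_exponent T (F : set T) t : 0 <= t -> ~ upper_exponent F t ->
  exists2 eta : R, 0 < eta & forall delta0 : R, 0 < delta0 ->
    exists2 delta, 0 < delta < delta0 & ~ has_cover Phi delta t eta F.
Proof.
move=> t0 nF; apply: contrapT => H; apply: nF; split=> // eps eps0.
apply: contrapT => H1; apply: H; exists eps => // delta0 d00.
apply: contrapT => H2; apply: H1; have [Delta0 _ _ _] := admPhi.
exists (Num.min delta0 (Num.min 1 Delta)); split.
- by rewrite !lt_min !ge_min d00 ltr01 Delta0 lexx orbT.
- by rewrite !ge_min lexx !orbT.
move=> delta; rewrite lt_min => /andP[d0 /andP[dd0 _]].
by apply: contrapT => ncov; apply: H2; exists delta; rewrite ?d0.
Qed.

Lemma not_lower_exponent T (F : set T) t : 0 <= t -> ~ lower_exponent F t ->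
  exists eta delta0 : R, [/\ 0 < eta, 0 < delta0 <= Delta &
    forall delta, 0 < delta < delta0 -> ~ has_cover Phi delta t eta F].
Proof.
move=> t0 nF; apply: contrapT => H; apply: nF; split=> // eps delta0 eps0 /andP[d00 d01].
apply: contrapT => H1; apply: H; have [Delta0 _ _ _] := admPhi.
exists eps, (Num.min delta0 Delta); split=> //.
  by rewrite lt_min d00 Delta0 ge_min lexx orbT.
move=> delta; rewrite lt_min => /andP[d0 /andP[dd0 dD]] cov.
by apply: H1; exists delta; rewrite d0.
Qed.

Section ProductExponents.
Context {X Y : metricType R} {d : X * Y -> X * Y -> R} (hd : is_metric d).
Context (dmax : comparable_to_max d).
Context {E : set X} {F : set Y}.
Context (annX : has_annuli X) (annY : has_annuli Y).
Context (dblE : doubling E) (dblF : doubling F) (E0 : E !=set0) (F0 : F !=set0).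

Local Notation EF := (E `*` F : set (metrized hd)).

(** If [t] is not a lower exponent, [F] lacks cheap covers at every small scale, in particular at
    all the scales where the product has one. *)
Lemma upper_exponent_fst u s t : upper_exponent EF u -> 0 <= s -> 0 <= t ->
  u <= s + t -> ~ lower_exponent F t -> upper_exponent E s.
Proof.
move=> [u0 EFcov] s0 t0 ust /(not_lower_exponent t0).
move=> [eta [d1 [eta0 /andP[d10 d1D] ncov]]]; split=> // eps eps0.
have us : 0 <= u <= s + t by rewrite u0.
have [C [d2 [C0 d20 cov]]] := product_cover_fst hd dmax admPhi annX annY dblE dblF
  E0 F0 s0 t0 us.
(* The cost is chosen so that [product_cover_fst] returns exactly [eps]. *)
have [|d3 [/andP[d30 d31] d3D cov3]] := EFcov (eps * eta / C).
  by rewrite divr_gt0 ?mulr_gt0.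
exists (Num.min d3 (Num.min d1 d2)); split.
- by rewrite !lt_min !ge_min d30 d10 d20 d31.
- by rewrite !ge_min d3D.
move=> delta; rewrite !lt_min => /andP[d0 /and3P[dd3 dd1 dd2]].
have -> : eps = C * (eps * eta / C) / eta by field; rewrite !gt_eqF.
apply: cov => //; first by rewrite d0.
  by apply: cov3; rewrite d0.
by apply: ncov; rewrite d0.
Qed.

(** The product has cheap covers only along some scales tending to 0, but [F] lacks them at all
    small scales, so both happen at a common scale. *)
Lemma lower_exponent_fst u s t : lower_exponent EF u -> 0 <= s -> 0 <= t ->
  u <= s + t -> ~ lower_exponent F t -> lower_exponent E s.
Proof.
move=> [u0 EFcov] s0 t0 ust /(not_lower_exponent t0).
move=> [eta [d1 [eta0 /andP[d10 d1D] ncov]]]; split=> // eps delta0 eps0 /andP[d00 d01].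
have us : 0 <= u <= s + t by rewrite u0.
have [C [d2 [C0 d20 cov]]] := product_cover_fst hd dmax admPhi annX annY dblE dblF
  E0 F0 s0 t0 us.
have [||delta []] := EFcov (eps * eta / C) (Num.min delta0 (Num.min d1 d2)).
- by rewrite divr_gt0 ?mulr_gt0.
- by rewrite !lt_min !ge_min d00 d10 d20 d01.
rewrite !lt_min => /andP[d0 /and3P[dd0 dd1 dd2]] dD covEF.
exists delta; split=> //; first by rewrite d0.
have -> : eps = C * (eps * eta / C) / eta by field; rewrite !gt_eqF.
apply: cov => //; first by rewrite d0.
by apply: ncov; rewrite d0.
Qed.

(** The bound on covering numbers of [F] holds at all small scales, so every small scale that is
    good for [E] is good for the product. *)
Lemma upper_exponent_box s t : (upper_box_dim F < t%:E)%E ->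
  upper_exponent E s -> upper_exponent EF (s + t).
Proof.
move=> Ft [s0 Ecov].
have t0 : 0 <= t by rewrite -lee_fin; apply: le_trans (ltW Ft); exact: upper_box_dim_ge0.
have [r0 r00 covF] := upper_box_dim_lt Ft.
have [C [d1 [C0 d10 cov]]] := product_cover_box hd dmax admPhi annX dblE dblF
  E0 F0 s0 t0 r00 covF.
split=> [|eps eps0]; first exact: addr_ge0.
have [|d2 [/andP[d20 d21] d2D cov2]] := Ecov (eps / C); first by rewrite divr_gt0.
exists (Num.min d2 d1); split.
- by rewrite !lt_min !ge_min d20 d10 d21.
- by rewrite !ge_min d2D.
move=> delta; rewrite !lt_min => /andP[d0 /andP[dd2 dd1]].
have -> : eps = C * (eps / C) by field; rewrite gt_eqF.
apply: cov; first by rewrite d0.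
by apply: cov2; rewrite d0.
Qed.

Lemma lower_exponent_box s t : (upper_box_dim F < t%:E)%E ->
  lower_exponent E s -> lower_exponent EF (s + t).
Proof.
move=> Ft [s0 Ecov].
have t0 : 0 <= t by rewrite -lee_fin; apply: le_trans (ltW Ft); exact: upper_box_dim_ge0.
have [r0 r00 covF] := upper_box_dim_lt Ft.
have [C [d1 [C0 d10 cov]]] := product_cover_box hd dmax admPhi annX dblE dblF
  E0 F0 s0 t0 r00 covF.
split=> [|eps delta0 eps0 /andP[d00 d01]]; first exact: addr_ge0.
have [||delta []] := Ecov (eps / C) (Num.min delta0 d1).
- by rewrite divr_gt0.
- by rewrite !lt_min !ge_min d00 d10 d01.
rewrite !lt_min => /andP[d0 /andP[dd0 dd1]] dD covE.
exists delta; split=> //; first by rewrite d0.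
have -> : eps = C * (eps / C) by field; rewrite gt_eqF.
by apply: cov => //; rewrite d0.
Qed.

Lemma upper_dim_product_ge :
  (upper_intermediate_dim X Delta Phi E + lower_intermediate_dim Y Delta Phi F
     <= upper_intermediate_dim (metrized hd) Delta Phi EF)%E.
Proof.
apply: ereal_inf_add_le; first by move=> s [].
- by move=> /upper_lower_exponent; exact: lower_exponent_gt0.
- exact: lower_exponent_gt0.
- by move=> s [].
- exact: upper_exponent_fst.
Qed.

Lemma lower_dim_product_ge :
  (lower_intermediate_dim X Delta Phi E + lower_intermediate_dim Y Delta Phi F
     <= lower_intermediate_dim (metrized hd) Delta Phi EF)%E.
Proof.
apply: ereal_inf_add_le; first by move=> s [].
- exact: lower_exponent_gt0.
- exact: lower_exponent_gt0.
- by move=> s [].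
- exact: lower_exponent_fst.
Qed.

Lemma upper_dim_product_le :
  (upper_intermediate_dim (metrized hd) Delta Phi EF
     <= upper_intermediate_dim X Delta Phi E + upper_box_dim F)%E.
Proof.
apply: ereal_inf_le_add; first exact: upper_box_dim_ge0.
- by move=> s [].
- by move=> s t Es Ft; exact: upper_exponent_box.
Qed.

Lemma lower_dim_product_le :
  (lower_intermediate_dim (metrized hd) Delta Phi EF
     <= lower_intermediate_dim X Delta Phi E + upper_box_dim F)%E.
Proof.
apply: ereal_inf_le_add; first exact: upper_box_dim_ge0.
- by move=> s [].
- by move=> s t Es Ft; exact: lower_exponent_box.
Qed.

End ProductExponents.

(** * Self-products *)

Section SelfProduct.
Context {X : metricType R} {d : X * X -> X * X -> R} (hd : is_metric d).
Context (dmax : comparable_to_max d).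
Context {F : set X}.
Context (annX : has_annuli X) (dblF : doubling F) (F0 : F !=set0).

(* Both factors fail to have cheap covers at the same scales, so no uniformity
   over all small scales is required of either. *)
Lemma upper_exponent_self_product u t :
  upper_exponent (F `*` F : set (metrized hd)) u -> 0 <= t -> u <= t + t ->
  upper_exponent F t.
Proof.
move=> [u0 FFcov] t0 ut; apply: contrapT => /(not_upper_exponent t0) [eta eta0 ncov].
have us : 0 <= u <= t + t by rewrite u0.
have [C [d1 [C0 d10 cov]]] := product_cover_fst hd dmax admPhi annX annX dblF dblF
  F0 F0 t0 t0 us.
(* With this cost, [product_cover_fst] yields a cover of [F] of cost [eta], the very one ruled out
   at the chosen scale. *)
have [|d2 [/andP[d20 _] _ cov2]] := FFcov (eta * eta / C).
  by rewrite divr_gt0 ?mulr_gt0.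
have [|delta] := ncov (Num.min d1 d2); first by rewrite lt_min d10.
rewrite lt_min => /andP[d0 /andP[dd1 dd2]] ncovd; apply: (ncovd).
rewrite [X in has_cover _ _ _ X](_ : _ = C * (eta * eta / C) / eta); last first.
  by field; rewrite !gt_eqF.
apply: cov => //; first by rewrite d0.
by apply: cov2; rewrite d0.
Qed.

Lemma upper_dim_self_product_ge :
  (2%:E * upper_intermediate_dim X Delta Phi F
     <= upper_intermediate_dim (metrized hd) Delta Phi (F `*` F))%E.
Proof.
apply: le_ereal_inf_tmp => _ [u Pu <-].
rewrite muleC -lee_pdivlMr//; apply: ereal_inf_lbound.
exists (u / 2) => //; apply: (upper_exponent_self_product Pu); have [] := Pu; lra.
Qed.

End SelfProduct.

End Exponents.

Local Open Scope ereal_scope.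

Theorem theorem5p4 (R : realType) (Delta : R) (Phi : R -> R)
    (hPhi : admissible Delta Phi) :
  (forall (X Y : metricType R) (d : X * Y -> X * Y -> R) (hd : is_metric d)
      (E : set X) (F : set Y),
    uniformly_perfect X -> uniformly_perfect Y ->
    (exists x x' : X, x <> x') -> (exists y y' : Y, y <> y') ->
    comparable_to_max d ->
    E !=set0 -> F !=set0 ->
    totally_bounded E -> totally_bounded F ->
    assouad_dim E \is a fin_num -> assouad_dim F \is a fin_num ->
    (upper_intermediate_dim X Delta Phi E + lower_intermediate_dim Y Delta Phi F
       <= upper_intermediate_dim (metrized hd) Delta Phi (E `*` F)
       <= upper_intermediate_dim X Delta Phi E + upper_box_dim F) /\
    (lower_intermediate_dim X Delta Phi E + lower_intermediate_dim Y Delta Phi F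
       <= lower_intermediate_dim (metrized hd) Delta Phi (E `*` F)
       <= lower_intermediate_dim X Delta Phi E + upper_box_dim F)) /\
  (forall (X : metricType R) (d : X * X -> X * X -> R) (hd : is_metric d)
      (F : set X),
    uniformly_perfect X ->
    (exists x x' : X, x <> x') ->
    comparable_to_max d ->
    F !=set0 -> totally_bounded F -> assouad_dim F \is a fin_num ->
    2%:E * upper_intermediate_dim X Delta Phi F
      <= upper_intermediate_dim (metrized hd) Delta Phi (F `*` F)
      <= upper_intermediate_dim X Delta Phi F + upper_box_dim F).
Proof.
split=> [X Y d hd E F upX upY X2 Y2 dmax E0 F0 _ _ aE aF|X d hd F upX X2 dmax F0 _ aF].
  have annX := uniformly_perfect_has_annuli upX X2.
  have annY := uniformly_perfect_has_annuli upY Y2.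
  have dblE := assouad_doubling aE; have dblF := assouad_doubling aF.
  split; apply/andP; split.
  - exact: upper_dim_product_ge.
  - exact: upper_dim_product_le.
  - exact: lower_dim_product_ge.
  - exact: lower_dim_product_le.
have annX := uniformly_perfect_has_annuli upX X2.
have dblF := assouad_doubling aF.
apply/andP; split; first exact: upper_dim_self_product_ge.
exact: upper_dim_product_le.
Qed.
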